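(* Let $n\ge1$, $f\in[0,1]^n\setminus\mathbb{Z}^n$ and $R,Q\subseteq\mathbb{R}^n$ (not necessarily finite) be such that the generalized corner relaxation $\mathcal{C}(f,R,Q)$ is non-empty. Then a valid cut $(\psi,\pi)$ for $\mathcal{C}(f,R,Q)$ is a split cut for $\mathcal{C}(f,R,Q)$ if and only if it is the restriction of a split cut for the infinite relaxation $\mathcal{C}(f,\mathbb{R}^n,\mathbb{R}^n)$, i.e., if and only if there is a split cut $(\psi',\pi')$ for $\mathcal{C}(f,\mathbb{R}^n,\mathbb{R}^n)$ with $\psi'|_R=\psi$ and $\pi'|_Q=\pi$.
   Context: For a set $T$, $\mathbb{R}^{(T)}_+$ denotes the set of functions $T\to\mathbb{R}_+=[0,\infty)$ with finite support. For $R,Q\subseteq\mathbb{R}^n$ (possibly infinite), $\mathcal{C}_{LP}(f,R,Q)$ is the set of all $(x,s,y)$ with $x\in\mathbb{R}^n$, $s\in\mathbb{R}^{(R)}_+$, $y\in\mathbb{R}^{(Q)}_+$ and $x=f+\sum_{r\in R} r\,s(r)+\sum_{q\in Q} q\,y(q)$. The generalized corner relaxation $\mathcal{C}(f,R,Q)$ is the set of $(x,s,y)\in\mathcal{C}_{LP}(f,R,Q)$ with $x\in\mathbb{Z}^n$ and $y(q)\in\mathbb{Z}$ for all $q\in Q$. A cut is a pair $(\psi,\pi)$ of non-negative functions $\psi:R\to\mathbb{R}_+$, $\pi:Q\to\mathbb{R}_+$; a point $(x,s,y)$ satisfies it if $\sum_{r\in R}\psi(r)s(r)+\sum_{q\in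 Q}\pi(q)y(q)\ge 1$. The cut is valid for $\mathcal{C}(f,R,Q)$ if every point of $\mathcal{C}(f,R,Q)$ satisfies it. For vectors $\alpha,v\in\mathbb{R}^n$, $\alpha v$ denotes their inner product, and $\mathbb{Z}_f=\{w\in\mathbb{Z}^n: wf\notin\mathbb{Z}\}$. For $\alpha\in\mathbb{Z}_f$ and $\beta:Q\to\mathbb{Z}$, let $$D(\alpha,\beta,f)=\Big\{(x,s,y):\alpha x+\sum_{q\in Q}\beta(q)y(q)\le\lfloor\alpha f\rfloor\Big\}\cup\Big\{(x,s,y):\alpha x+\sum_{q\in Q}\beta(q)y(q)\ge\lceil\alpha f\rceil\Big\}.$$ A cut $(\psi,\pi)$ is a split cut for $\mathcal{C}(f,R,Q)$ if for some $\alpha\in\mathbb{Z}_f$ and $\beta:Q\to\mathbb{Z}$ it is satisfied by all points of $\mathcal{C}_{LP}(f,R,Q)\cap D(\alpha,\beta,f)$. The same definitions apply with $R=Q=\mathbb{R}^n$. *)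

(* Defs.v *)
From mathcomp Require Export all_boot all_order all_algebra.
From mathcomp Require Export mathcomp_extra boolp classical_sets functions.
From mathcomp Require Export cardinality fsbigop reals.

Set Implicit Arguments.
Unset Strict Implicit.
Unset Printing Implicit Defensive.

Import Order.TTheory GRing.Theory Num.Theory.
Local Open Scope classical_set_scope.
Local Open Scope ring_scope.

Section GeneralizedCornerRelaxation.
Context {K : realType} {n : nat}.
Local Notation V := 'rV[K]_n.
Implicit Types (f a v : V) (R Q : set V).

Definition inner a v : K := \sum_(i < n) a 0 i * v 0 i.

Definition Zn : set V := [set v | forall i, v 0 i \is a Num.int].

Definition unit_cube : set V := [set v | forall i, 0 <= v 0 i <= 1].

Definition Zf f : set V := [set w | Zn w /\ inner w f \isn't a Num.int].

(* A set [T : set V] used as a type is the subtype of its elements, so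
   [T -> K] is the type of functions defined on [T] only. *)
Definition nonneg_fun (T : set V) (g : T -> K) : Prop := forall t, 0 <= g t.

Definition fin_supp_nonneg (T : set V) : set (T -> K) :=
  [set g | nonneg_fun g /\ finite_set [set t | g t != 0]].

Record point (R Q : set V) := Point { px : V; ps : R -> K; py : Q -> K }.

(* The sums [\sum_(t \in [set: T]) F t] below are over the support of [F],
   which is finite because [s] and [y] have finite support. *)
Definition corner_LP f R Q : set (point R Q) :=
  [set p | [/\ fin_supp_nonneg (ps p), fin_supp_nonneg (py p) &
    px p = f + \sum_(r \in [set: R]) ps p r *: val r
             + \sum_(q \in [set: Q]) py p q *: val q]].

Definition corner f R Q : set (point R Q) :=
  [set p | [/\ corner_LP f p, Zn (px p) & forall q, py p q \is a Num.int]].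

Definition is_cut R Q (psi : R -> K) (pi : Q -> K) : Prop :=
  nonneg_fun psi /\ nonneg_fun pi.

Definition satisfies R Q (psi : R -> K) (pi : Q -> K) (p : point R Q) : Prop :=
  1 <= \sum_(r \in [set: R]) psi r * ps p r
     + \sum_(q \in [set: Q]) pi q * py p q.

Definition valid_cut f R Q (psi : R -> K) (pi : Q -> K) : Prop :=
  is_cut psi pi /\ forall p : point R Q, corner f p -> satisfies psi pi p.

Definition split_form R Q (alpha : V) (beta : Q -> int) (p : point R Q) : K :=
  inner alpha (px p) + \sum_(q \in [set: Q]) (beta q)%:~R * py p q.

Definition split_disj R Q (alpha : V) (beta : Q -> int) f : set (point R Q) :=
  [set p | split_form alpha beta p <= (Num.floor (inner alpha f))%:~R] `|`
  [set p | (Num.ceil (inner alpha f))%:~R <= split_form alpha beta p].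

Definition split_cut f R Q (psi : R -> K) (pi : Q -> K) : Prop :=
  is_cut psi pi /\
  exists (alpha : V) (beta : Q -> int), Zf f alpha /\
    forall p : point R Q, (@corner_LP f R Q `&` split_disj alpha beta f) p ->
      satisfies psi pi p.

Definition restr (T : set V) (g : [set: V] -> K) : T -> K :=
  fun t => g (SigSub (in_setT (val t))).

End GeneralizedCornerRelaxation.

Arguments corner_LP {K n} f R Q.
Arguments corner {K n} f R Q.
Arguments Zn {K} n.
Arguments unit_cube {K} n.
Arguments split_cut {K n} f R Q psi pi.
Arguments valid_cut {K n} f R Q psi pi.
Arguments restr {K n} T g.

(* Main.v *)
Require Import Defs.
From mathcomp Require Import finmap lra.

(** Fix [alpha] in [Zf f] and put [a = inner alpha f], which lies strictly
    between its floor and its ceiling.  Points of [corner_LP f R Q] are free to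
    move along every single ray, so whether a cut holds on
    [corner_LP f R Q `&` split_disj alpha beta f] can be read off coefficient by
    coefficient: it holds exactly when

      psi r >= gauge a (alpha r)   and   pi q >= gauge a (alpha q + beta q)

    for all [r] in [R] and [q] in [Q], where [gauge a] is the gauge function of
    the interval [floor a - a, ceil a - a] (lemma [satisfies_split_disjP]).
    If the bounds hold, sublinearity of the gauge gives the cut, because a point
    lies in the split disjunction exactly when the total displacement of
    [split_form] from [a] has gauge at least 1 (lemma [gauge_ge1]).  Conversely,
    walking from [f] along one ray until the displacement has gauge exactly 1
    reaches a point of the disjunction, and the cut at that point is the bound
    for that ray.

    These bounds concern each vector separately, so they are inherited by
    restrictions; and a cut on [R] and [Q] that fulfils them extends to all
    vectors by giving each missing vector [v] the coefficient
    [gauge a (alpha v)], with [beta v = 0]. *)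

Set Implicit Arguments.
Unset Strict Implicit.
Unset Printing Implicit Defensive.
Import Order.TTheory GRing.Theory Num.Theory.
Local Open Scope classical_set_scope.
Local Open Scope ring_scope.

Lemma innerD (K : realType) (n : nat) (a u v : 'rV[K]_n) :
  inner a (u + v) = inner a u + inner a v.
Proof. by rewrite -big_split; apply: eq_bigr => i _; rewrite mxE mulrDr. Qed.

Lemma innerZ (K : realType) (n : nat) (k : K) (a v : 'rV[K]_n) :
  inner a (k *: v) = k * inner a v.
Proof. by rewrite mulr_sumr; apply: eq_bigr => i _; rewrite mxE mulrCA. Qed.

Lemma inner0 (K : realType) (n : nat) (a : 'rV[K]_n) : inner a 0 = 0.
Proof. by rewrite -(scale0r 0) innerZ mul0r. Qed.

(** Additivity and monotonicity of finitely supported sums need the sums to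
    range over a common finite set; the support of the multiplier [s] serves
    for all sums occurring here. *)
Lemma fsum_supp (K : realType) (M : nmodType) (T : choiceType)
    (s : T -> K) (F : T -> M) :
  finite_set [set t | s t != 0] -> (forall t, s t = 0 -> F t = 0) ->
  \sum_(t \in [set: T]) F t = \sum_(t <- fset_set [set t | s t != 0]) F t.
Proof.
move=> fs F0; rewrite -fsbig_finite//; apply/esym/fsbig_widen => // t [_ /=].
by move=> /negP; rewrite negbK => /eqP /F0.
Qed.

Lemma inner_fsum (K : realType) (n : nat) (T : set 'rV[K]_n) (a : 'rV[K]_n)
    (s : T -> K) :
  finite_set [set t | s t != 0] ->
  inner a (\sum_(t \in [set: T]) s t *: val t) =
  \sum_(t \in [set: T]) inner a (val t) * s t.
Proof.
move=> fs; rewrite !(fsum_supp fs).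
- rewrite (big_morph (inner a) (innerD a) (inner0 a)).
  by apply: eq_bigr => t _; rewrite innerZ mulrC.
- by move=> t ->; rewrite mulr0.
- by move=> t ->; rewrite scale0r.
Qed.

(** On the LP relaxation [px p] is determined by the multipliers, so the split
    form is its value at [f] plus a linear form in the multipliers. *)
Lemma split_form_corner_LP (K : realType) (n : nat) (f alpha : 'rV[K]_n)
    (R Q : set 'rV[K]_n) (beta : Q -> int) (p : point R Q) :
  corner_LP f R Q p ->
  split_form alpha beta p = inner alpha f +
    (\sum_(r \in [set: R]) inner alpha (val r) * ps p r +
     \sum_(q \in [set: Q]) (inner alpha (val q) + (beta q)%:~R) * py p q).
Proof.
case=> -[_ fs] [_ fy] px_eq; rewrite /split_form px_eq !innerD !inner_fsum//.
rewrite -!addrA; do 2 congr (_ + _).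
rewrite !(fsum_supp fy) -?big_split; first by apply: eq_bigr => q _; rewrite mulrDl.
all: by move=> q ->; rewrite mulr0.
Qed.

Lemma ler_fsum_fin_supp (K : realType) (n : nat) (T : set 'rV[K]_n) (k : K)
    (c w s : T -> K) :
  fin_supp_nonneg s -> (forall t, k * c t <= w t) ->
  k * \sum_(t \in [set: T]) c t * s t <= \sum_(t \in [set: T]) w t * s t.
Proof.
case=> s0 fs cw; rewrite !(fsum_supp fs); try by move=> t ->; rewrite mulr0.
by rewrite mulr_sumr; apply: ler_sum => t _; rewrite mulrA ler_wpM2r ?s0.
Qed.

(** Points with a single nonzero multiplier are the test points that recover
    the individual coefficients of a cut. *)
Definition atom (K : realType) (T : choiceType) (t0 : T) (l : K) : T -> K :=
  fun t => if t == t0 then l else 0.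

Lemma fin_supp_atom (K : realType) (n : nat) (T : set 'rV[K]_n) (t0 : T) (l : K) :
  0 <= l -> fin_supp_nonneg (atom t0 l).
Proof.
move=> l0; split=> [t|]; first by rewrite /atom; case: ifP.
apply: (sub_finite_set _ (finite_set1 t0)) => t /=.
by rewrite /atom; case: (eqVneq t t0) => // _; rewrite eqxx.
Qed.

Lemma fin_supp0 (K : realType) (n : nat) (T : set 'rV[K]_n) :
  fin_supp_nonneg (fun _ : T => 0 : K).
Proof.
split=> [t //|]; rewrite (_ : [set _ | _] = set0) ?finite_set0//.
by apply/seteqP; split=> t //=; rewrite eqxx.
Qed.

Lemma fsum_atomM (K : realType) (T : choiceType) (c : T -> K) (t0 : T) (l : K) :
  \sum_(t \in [set: T]) c t * atom t0 l t = c t0 * l.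
Proof.
rewrite -(fsbig_widen [set t0])//; first by rewrite fsbig_set1 /atom eqxx.
by move=> t [_ /= /eqP/negPf tt0]; rewrite /atom tt0 mulr0.
Qed.

Lemma fsum_atomZ (K : realType) (W : lmodType K) (T : choiceType) (c : T -> W)
    (t0 : T) (l : K) :
  \sum_(t \in [set: T]) atom t0 l t *: c t = l *: c t0.
Proof.
rewrite -(fsbig_widen [set t0])//; first by rewrite fsbig_set1 /atom eqxx.
by move=> t [_ /= /eqP/negPf tt0]; rewrite /atom tt0 scale0r.
Qed.

Lemma fsum_mulr0 (K : realType) (T : choiceType) (c : T -> K) :
  \sum_(t \in [set: T]) c t * 0 = 0.
Proof. by rewrite fsbig1// => t _; rewrite mulr0. Qed.

Lemma fsum_scale0r (K : realType) (W : lmodType K) (T : choiceType)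
    (c : T -> W) :
  \sum_(t \in [set: T]) (0 : K) *: c t = 0.
Proof. by rewrite fsbig1// => t _; rewrite scale0r. Qed.

(** The gauge function of the interval [floor a - a, ceil a - a] around 0. *)
Definition gauge (K : realType) (a t : K) : K :=
  Num.max (t / ((Num.ceil a)%:~R - a)) (- t / (a - (Num.floor a)%:~R)).

Lemma split_gap (K : realType) (a : K) : a \isn't a Num.int ->
  0 < a - (Num.floor a)%:~R /\ 0 < (Num.ceil a)%:~R - a.
Proof.
move=> aNint; rewrite !subr_gt0 !lt_neqAle floor_le ceil_ge !andbT.
by rewrite -intrEfloor eq_sym -intrEceil.
Qed.

Lemma gauge_ge0 (K : realType) (a t : K) : a \isn't a Num.int -> 0 <= gauge a t.
Proof.
move=> /split_gap[lo hi]; rewrite /gauge le_max; case: (lerP 0 t) => t0.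
  by rewrite divr_ge0// ltW.
by rewrite orbC divr_ge0// ltW// oppr_gt0.
Qed.

Lemma gaugeZ (K : realType) (a k t : K) : 0 <= k ->
  gauge a (k * t) = k * gauge a t.
Proof. by move=> k0; rewrite /gauge maxr_pMr// -mulrN !mulrA. Qed.

Lemma gauge_ge1 (K : realType) (a t : K) : a \isn't a Num.int ->
  (1 <= gauge a t) =
  (a + t <= (Num.floor a)%:~R) || ((Num.ceil a)%:~R <= a + t).
Proof.
move=> /split_gap[lo hi]; rewrite /gauge le_max !ler_pdivlMr// !mul1r orbC.
by congr (_ || _); apply/idP/idP => ?; lra.
Qed.

(** Necessity comes from the points [f + l *: v] with a single multiplier [l],
    sufficiency from sublinearity of the gauge.  As the conditions treat the
    vectors one at a time, they do not depend on which other vectors belong to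
    [R] and [Q]. *)
Lemma satisfies_split_disjP (K : realType) (n : nat) (f alpha : 'rV[K]_n)
    (R Q : set 'rV[K]_n) (beta : Q -> int) (psi : R -> K) (pi : Q -> K) :
  Zf f alpha -> is_cut psi pi ->
  (forall p, (corner_LP f R Q `&` split_disj alpha beta f) p ->
     satisfies psi pi p) <->
  (forall r, gauge (inner alpha f) (inner alpha (val r)) <= psi r) /\
  (forall q, gauge (inner alpha f) (inner alpha (val q) + (beta q)%:~R) <= pi q).
Proof.
move=> [_ fNint] [psi0 pi0]; set a := inner alpha f in fNint *.
(* The step length that reaches the boundary of the split is the inverse of the
   gauge; a ray of gauge 0 never leaves the strip and imposes nothing. *)
have ray c w : 0 <= w ->
    (forall l, 0 <= l -> 1 <= gauge a (c * l) -> 1 <= w * l) -> gauge a c <= w.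
  move=> w0 H; have := gauge_ge0 c fNint.
  rewrite le_eqVlt => /predU1P[<-//|g0].
  have := H (gauge a c)^-1; rewrite [c * _]mulrC gaugeZ ?invr_ge0 ?(ltW g0)//.
  by rewrite mulVf ?gt_eqF// lexx ler_pdivlMr// mul1r; apply.
split=> [H|[psiH piH] p [pLP pD]].
- split=> [r|q]; apply: ray => // l l0 gl.
  + pose p := @Point K n R Q (f + l *: val r) (atom r l) (fun=> 0).
    have pLP : corner_LP f R Q p.
      split; [exact: fin_supp_atom|exact: fin_supp0|].
      by rewrite /= fsum_atomZ fsum_scale0r addr0.
    suff : satisfies psi pi p.
      by rewrite /satisfies /= fsum_atomM fsum_mulr0 addr0.
    apply: H; split=> //; apply/orP.
    rewrite /= (split_form_corner_LP _ _ pLP) -gauge_ge1//=.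
    by rewrite fsum_atomM fsum_mulr0 addr0.
  + pose p := @Point K n R Q (f + l *: val q) (fun=> 0) (atom q l).
    have pLP : corner_LP f R Q p.
      split; [exact: fin_supp0|exact: fin_supp_atom|].
      by rewrite /= fsum_atomZ fsum_scale0r addr0.
    suff : satisfies psi pi p.
      by rewrite /satisfies /= fsum_atomM fsum_mulr0 add0r.
    apply: H; split=> //; apply/orP.
    rewrite /= (split_form_corner_LP _ _ pLP) -gauge_ge1//=.
    by rewrite fsum_atomM fsum_mulr0 add0r.
- have [sF yF _] := pLP.
  (* The gauge is the maximum of two linear functions [t |-> k * t]; each is
     summed separately. *)
  have bound k : (forall t, k * t <= gauge a t) ->
      k * (\sum_(r \in [set: R]) inner alpha (val r) * ps p r +
           \sum_(q \in [set: Q]) (inner alpha (val q) + (beta q)%:~R) * py p q)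
      <= \sum_(r \in [set: R]) psi r * ps p r
         + \sum_(q \in [set: Q]) pi q * py p q.
    move=> kg; rewrite mulrDr.
    by apply: lerD; apply: ler_fsum_fin_supp => // t; exact: le_trans (kg _) _.
  move: pD => /orP; rewrite (split_form_corner_LP _ _ pLP) -gauge_ge1// => g1.
  apply: (le_trans g1); rewrite /gauge ge_max; apply/andP; split.
    by rewrite mulrC; apply: bound => t; rewrite mulrC /gauge le_max lexx.
  rewrite mulNr -mulrN mulrC; apply: bound => t.
  by rewrite mulrC mulrN -mulNr /gauge le_max lexx orbT.
Qed.

(** Elements of [[set: 'rV[K]_n]] are subtype elements, so [insub] decides
    whether the underlying vector belongs to [T] and casts it there. *)
Definition extend (K : realType) (n : nat) (T : set 'rV[K]_n) (A : Type)
    (g : T -> A) (d : 'rV[K]_n -> A) (t : [set: 'rV[K]_n]) : A :=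
  oapp g (d (val t)) (insub (val t)).

Lemma restr_extend (K : realType) (n : nat) (T : set 'rV[K]_n)
    (g : T -> K) (d : 'rV[K]_n -> K) : restr T (extend g d) = g.
Proof. by apply/funext => t; rewrite /restr /extend /= valK. Qed.

Theorem theorem2 (K : realType) (n : nat) (hn : (1 <= n)%N)
    (f : 'rV[K]_n) (hf : (unit_cube n `\` Zn n) f)
    (R Q : set 'rV[K]_n) (hne : corner f R Q !=set0)
    (psi : R -> K) (pi : Q -> K) (hvalid : valid_cut f R Q psi pi) :
  split_cut f R Q psi pi <->
  exists (psi' : [set: 'rV[K]_n] -> K) (pi' : [set: 'rV[K]_n] -> K),
    [/\ split_cut f [set: 'rV[K]_n] [set: 'rV[K]_n] psi' pi',
        restr R psi' = psi & restr Q pi' = pi].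
Proof.
split=> [[cut [alpha [beta [aZf]]]]|[psi' [pi' [[cut' [alpha [beta' [aZf]]]]]]]].
- move=> /(satisfies_split_disjP _ aZf cut)[psiH piH].
  have [psi0 pi0] := cut; have [_ fNint] := aZf.
  pose phi v := gauge (inner alpha f) (inner alpha v).
  exists (extend psi phi), (extend pi phi); split; try exact: restr_extend.
  have cut' : is_cut (extend psi phi) (extend pi phi).
    by split=> t; rewrite /extend; case: insubP => //= *; exact: gauge_ge0.
  split=> //; exists alpha, (extend beta (fun=> 0)); split=> //.
  apply/satisfies_split_disjP => //; split=> t; rewrite /extend.
    by case: insubP => [r _ <-|_] /=; [exact: psiH|exact: lexx].
  case: insubP => [q _ <-|_] /=; first exact: piH.
  by rewrite addr0 lexx.
- move=> /(satisfies_split_disjP _ aZf cut')[psiH piH] psiE piE.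
  have [cut _] := hvalid; split=> //.
  exists alpha, (fun q => beta' (SigSub (in_setT (val q)))); split=> //.
  apply/satisfies_split_disjP => //; split=> t.
    by rewrite -psiE; exact: psiH (SigSub (in_setT (val t))).
  by rewrite -piE; exact: piH (SigSub (in_setT (val t))).
Qed.
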